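(* Assume $\operatorname{rank}G(x_e)<n$. Then $0\in\operatorname{int}V(x_e)$ never holds (interior taken in $\mathbb{R}^n$), whereas $$\mathcal{B}(x_e)\cap\operatorname{int}\Omega(x_e)\neq\emptyset$$ may hold whenever $f_0(x_e)\in\operatorname{Im}G(x_e)$ with the balancing coefficients strictly inside the input box. The $\mathcal{B}$-classification is therefore strictly more general than the ambient-space condition on $V(x_e)$.
   Context: Let $f_0,g_1,\dots,g_m$ be vector fields on $\mathbb{R}^n$ of class $C^\nu$, $\nu\in\mathbb{Z}_{\ge1}\cup\{\infty,\omega\}$, let $G(x):=[g_1(x)\ \cdots\ g_m(x)]\in\mathbb{R}^{n\times m}$, and consider the control-affine system $\dot x=f_0(x)+G(x)u$, $u\in\Omega(x)$, with input box $\Omega(x)=\prod_{i=1}^m[\underline u_i(x),\overline u_i(x)]\subset\mathbb{R}^m$. Standing assumptions: $\underline u_i,\overline u_i:\mathbb{R}^n\to\mathbb{R}$ are continuous with $\underline u_i(x)<\overline u_i(x)$ for all $x,i$, and either $0<\underline u_i(x)$ for all $x,i$, or $\overline u_i(x)<0$ for all $x,i$. The point $x_e\in\mathbb{R}^n$ is a reference state. Feasible velocity set: $V(x):=\{f_0(x)+G(x)u:u\in\Omega(x)\}\subset\mathbb{R}^n$. The ambient-space condition on $V(x_e)$ is $0\in\operatorname{int}V(x_e)$. Admissible balancing set: $\mathcal{B}(x_e):=\{u\in\Omega(x_e):f_0(x_e)+G(x_e)u=0\}$. Balancing coefficients are the components $u_i$ of a solution $u\in\mathbb{R}^m$ of $f_0(x_e)+G(x_e)u=0$.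 The $\mathcal{B}$-classification assigns each reference state $x_e$ to exactly one of three regimes: Case (A), $\mathcal{B}(x_e)\cap\operatorname{int}\Omega(x_e)\neq\emptyset$ (the favorable regime); Case (B), $\mathcal{B}(x_e)=\emptyset$; Case (C), $\mathcal{B}(x_e)\neq\emptyset$ and $\mathcal{B}(x_e)\cap\operatorname{int}\Omega(x_e)=\emptyset$. *)

(* Defs.v *)
(* Points of R^k are column vectors 'cV[R]_k. *)
From HB Require Import structures.
From mathcomp Require Import all_boot all_order all_algebra.
From mathcomp Require Import all_classical all_reals all_analysis.
From mathcomp Require analysis.showcase.summability.
Import Order.TTheory GRing.Theory Num.Theory.
Import numFieldNormedType.Exports.

Set Implicit Arguments.
Unset Strict Implicit.
Unset Printing Implicit Defensive.

Local Open Scope classical_set_scope.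
Local Open Scope ring_scope.

(* Regularity classes C^k, C^infinity and C^omega; the side condition nu >= 1
   is [ge1_class]. *)
Inductive smoothness := Cfinite of nat | Cinfty | Comega.

Definition ge1_class (nu : smoothness) : Prop :=
  if nu is Cfinite k then (1 <= k)%N else True.

Section Smoothness.
Variables (R : realType) (n : nat).
Implicit Type f : 'cV[R]_n -> 'cV[R]_n.

Fixpoint is_Ck (k : nat) f : Prop :=
  continuous f /\
  if k is k'.+1 then
    forall i : 'I_n, (forall x, derivable f x (delta_mx i 0)) /\
                     is_Ck k' (fun x => 'D_(delta_mx i 0) f x)
  else True.

Definition monomial (al : {ffun 'I_n -> nat}) (z : 'cV[R]_n) : R :=
  \prod_(i < n) z i 0 ^+ al i.

(* Around each point, f is the sum of a power series in n variables. The
   multi-indices are {ffun 'I_n -> nat}, and the finite partial sums converge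
   along the directed set of finite sets of multi-indices: this is unconditional
   (in finite dimension, absolute) convergence. *)
Definition is_analytic f : Prop :=
  forall x : 'cV[R]_n, exists a : {ffun 'I_n -> nat} -> 'cV[R]_n,
    \forall y \near x,
      summability.partial_sum
        (fun al => monomial al (y - x) *: a al)
        @ summability.totally --> f y.

Definition of_class (nu : smoothness) f : Prop :=
  match nu with
  | Cfinite k => is_Ck k f
  | Cinfty => forall k, is_Ck k f
  | Comega => is_analytic f
  end.

End Smoothness.

Record control_system (R : realType) (n m : nat) := ControlSystem {
  drift : 'cV[R]_n -> 'cV[R]_n;
  input_field : 'I_m -> 'cV[R]_n -> 'cV[R]_n;
  input_lo : 'I_m -> 'cV[R]_n -> R;
  input_hi : 'I_m -> 'cV[R]_n -> R }.

Inductive regime := CaseA | CaseB | CaseC.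

Section ControlSystem.
Variables (R : realType) (n m : nat).
Implicit Types (S : control_system R n m) (x : 'cV[R]_n).

Definition standing_assumptions (nu : smoothness) S : Prop :=
  [/\ of_class nu (drift S),
      forall j, of_class nu (input_field S j),
      forall i, continuous (input_lo S i) /\ continuous (input_hi S i),
      forall i x, input_lo S i x < input_hi S i x &
      (forall i x, 0 < input_lo S i x) \/ (forall i x, input_hi S i x < 0)].

Definition input_matrix S x : 'M[R]_(n, m) :=
  \matrix_(i, j) input_field S j x i 0.

Definition input_box S x : set 'cV[R]_m :=
  [set u | forall i, input_lo S i x <= u i 0 <= input_hi S i x].

Definition velocity_set S x : set 'cV[R]_n :=
  [set drift S x + input_matrix S x *m u | u in input_box S x].

Definition ambient_condition S x : Prop := (velocity_set S x)° 0.

Definition balancing S x (u : 'cV[R]_m) : Prop :=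
  drift S x + input_matrix S x *m u = 0.

Definition balancing_set S x : set 'cV[R]_m :=
  [set u | input_box S x u /\ balancing S x u].

Definition has_regime S x (r : regime) : Prop :=
  match r with
  | CaseA => balancing_set S x `&` (input_box S x)° !=set0
  | CaseB => balancing_set S x = set0
  | CaseC => balancing_set S x !=set0 /\
             balancing_set S x `&` (input_box S x)° = set0
  end.

Lemma has_regime_unique S x : exists! r, has_regime S x r.
Proof.
have [B0|/set0P Bn0] := eqVneq (balancing_set S x) set0.
  exists CaseB; split=> // -[] //=; rewrite B0 ?set0I.
    by move/set0P; rewrite eqxx.
  by case=> /set0P; rewrite eqxx.
have [I0|/set0P In0] :=
  eqVneq (balancing_set S x `&` (input_box S x)°) set0.
  exists CaseC; split=> // -[] //=.
    by move/set0P; rewrite I0 eqxx.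
  by move=> B0; move/set0P: Bn0; rewrite B0 eqxx.
exists CaseA; split=> // -[] //=.
  by move=> B0; move/set0P: Bn0; rewrite B0 eqxx.
by case=> _ I0; move/set0P: In0; rewrite I0 eqxx.
Qed.

End ControlSystem.

(* Main.v *)
(* If 0 is interior to V(x), every direction v has a small multiple e v in V(x).
   Subtracting two velocities cancels the drift, so v is in Im G(x), which is
   therefore all of R^n; this excludes rank G(x) < n. *)
Require Import Defs.
From mathcomp Require Import all_boot all_order all_algebra finmap.
From mathcomp Require Import all_classical all_reals all_analysis.
From mathcomp Require Import lra.
From mathcomp Require analysis.showcase.summability.
Import Order.TTheory GRing.Theory Num.Theory.
Import numFieldNormedType.Exports.
Local Open Scope classical_set_scope.
Local Open Scope ring_scope.

Lemma is_Ck_cst (R : realType) (n k : nat) (c : 'cV[R]_n) :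
  is_Ck k (fun=> c).
Proof.
elim: k c => [|k IHk] c; (split; first exact: cst_continuous) => // i.
split=> [x|]; first exact: derivable_cst.
have -> : 'D_(delta_mx i 0 : 'cV[R]_n) (fun=> c) = fun=> 0.
  by apply/funext => x; exact: derive_cst.
exact: IHk.
Qed.

(** The series has [c] at the zero multi-index as its only possibly nonzero coefficient, so partial
    sums over finite sets containing that index are all equal to [c]. *)
Lemma is_analytic_cst (R : realType) (n : nat) (c : 'cV[R]_n) :
  is_analytic (fun=> c).
Proof.
move=> x; pose z : {ffun 'I_n -> nat} := [ffun=> 0%N].
exists (fun al => if al == z then c else 0); near=> y.
have totallyF := @summability.totally_filter {ffun 'I_n -> nat}.
have near_z : summability.totally [set A : {fset _} | z \in A].
  by exists [fset z]%fset => // A /=; rewrite fsub1set.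
apply: cvg_near_cst; apply: filterS near_z => A /= zA.
pose F al := monomial al (y - x) *: (if al == z then c else 0).
transitivity (\sum_(al <- A) F al); first by rewrite big_seq_fsetE.
rewrite (bigD1_seq z) ?fset_uniq //= /F eqxx big1 ?addr0; last first.
  by move=> al /negbTE ->; rewrite scaler0.
by rewrite /monomial big1 ?scale1r// => i _; rewrite ffunE expr0.
Unshelve. all: by end_near. Qed.

Lemma of_class_cst (R : realType) (n : nat) (nu : smoothness) (c : 'cV[R]_n) :
  of_class nu (fun=> c).
Proof.
case: nu => [k| |] /=; [exact: is_Ck_cst| |exact: is_analytic_cst].
by move=> k; exact: is_Ck_cst.
Qed.

Lemma surjective_mulmx_rank (F : fieldType) (n m : nat) (A : 'M[F]_(n, m)) :
  (forall v : 'cV[F]_n, exists u, v = A *m u) -> \rank A = n.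
Proof.
(* Fullness is tested on row spaces, hence the transpose: each row of the identity must lie in the
   row space of [A^T]. *)
move=> surjA; rewrite -mxrank_tr; apply/eqP.
rewrite -[_ == n]/(row_full A^T) -sub1mx; apply/row_subP => i.
have [u eu] := surjA (row i 1%:M)^T.
by rewrite -[row i _]trmxK eu trmx_mul submxMl.
Qed.

Lemma nbhs0_ray (R : realType) (V : normedModType R) (A : set V) (v : V) :
  nbhs 0 A -> exists2 e : R, 0 < e & A (e *: v).
Proof.
move=> A0; have Aev : \forall e \near (0 : R)^'+, A (e *: v).
  apply: cvg_within; apply: (@scalel_continuous _ _ v 0).
  by rewrite scale0r.
have [e [e0 Ae]] := filter_ex (filterI (nbhs_right_gt (0 : R)) Aev).
by exists e.
Qed.

Section ControlSystem.
Variables (R : realType) (n m : nat).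
Implicit Types (S : control_system R n m) (x : 'cV[R]_n) (u : 'cV[R]_m).

(** Coordinates are continuous and finite in number, so the strict bounds persist near [u]. *)
Lemma interior_input_box S x u :
  (forall i, input_lo S i x < u i 0 < input_hi S i x) ->
  (input_box S x)° u.
Proof.
move=> u_in.
apply: (@filter_forall _ _ _ _ (nbhs_filter u)) => i.
have lohi : u i 0 \in `]input_lo S i x, input_hi S i x[ by rewrite in_itv /=.
have := coord_continuous (near_in_itvoo lohi).
apply: (@filterS _ _ (nbhs_filter u)) => w /=; rewrite in_itv /= => /andP[lo hi].
by rewrite !ltW.
Qed.

Lemma caseA_of_strict S x u :
  balancing S x u -> (forall i, input_lo S i x < u i 0 < input_hi S i x) ->
  has_regime S x CaseA.
Proof.
move=> bal /interior_input_box u_in; exists u; split=> //.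
by split=> //; exact: interior_subset u_in.
Qed.

Definition box_center S x : 'cV[R]_m :=
  \col_i ((input_lo S i x + input_hi S i x) / 2).

Lemma box_center_strict S x :
  (forall i, input_lo S i x < input_hi S i x) ->
  forall i, input_lo S i x < box_center S x i 0 < input_hi S i x.
Proof. by move=> lohi i; rewrite mxE !midf_lt. Qed.

Lemma ambient_full_rank S x :
  ambient_condition S x -> \rank (input_matrix S x) = n.
Proof.
move=> amb; apply: surjective_mulmx_rank => v.
have [u0 _ eu0] : velocity_set S x 0 := nbhs_singleton amb.
have [e e0 [u _ eu]] := nbhs0_ray _ _ _ v amb.
exists (e^-1 *: (u - u0)); rewrite -scalemxAr mulmxBr.
(* Adding the drift to both terms turns them into the velocities [e *: v] and [0]. *)
rewrite -(addrKA (drift S x)) ![_ + drift S x]addrC eu eu0 subr0.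
by rewrite scalerA mulVf ?scale1r ?gt_eqF.
Qed.

(* If v is the velocity at the centre of the box and - e v is attained at u,
   then (u + e centre) / (1 + e) is balancing and strictly inside the box. *)
Lemma ambient_caseA S x :
  (forall i, input_lo S i x < input_hi S i x) ->
  ambient_condition S x -> has_regime S x CaseA.
Proof.
move=> /box_center_strict; set c := box_center S x => c_in amb.
have [e e0 [u u_in eu]] :=
  nbhs0_ray _ _ _ (- (drift S x + input_matrix S x *m c)) amb.
have e1 : 0 < 1 + e by rewrite addr_gt0.
apply: (@caseA_of_strict _ _ ((1 + e)^-1 *: (u + e *: c))).
  (* Multiplied by [1 + e], the balance equation splits into the velocity at [u] plus [e] times the
     velocity at [c], and these cancel. *)
  apply: (scalerI (lt0r_neq0 e1)); rewrite scaler0 scalerDr -scalemxAr.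
  rewrite scalerA divff ?gt_eqF// scale1r mulmxDr -scalemxAr scalerDl scale1r.
  by rewrite addrACA eu -scalerDr -scalerDr addNr scaler0.
move=> i; have /andP[c_lo c_hi] := c_in i; have /andP[u_lo u_hi] := u_in i.
(* [u] may lie on the boundary of the box; strictness comes from [c], whose weight [e] is
   positive. *)
rewrite 3!mxE mulrC ltr_pdivlMr// ltr_pdivrMr//.
by apply/andP; split; nra.
Qed.

End ControlSystem.
Arguments box_center {R n m} S x.

Theorem proposition3 (R : realType) (n m : nat) (nu : smoothness)
    (nu_ge1 : ge1_class nu) :
  (* rank-deficient reference states *)
  (forall (S : control_system R n m) (xe : 'cV[R]_n),
     standing_assumptions nu S ->
     (\rank (input_matrix S xe) < n)%N ->
     (* the ambient-space condition never holds *)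
     [/\ ~ ambient_condition S xe,
     (* the favorable regime holds whenever the drift lies in the image of G,
        with balancing coefficients strictly inside the box *)
         (range (mulmx (input_matrix S xe) : 'cV[R]_m -> 'cV[R]_n) (drift S xe) ->
          (exists u : 'cV[R]_m, balancing S xe u /\
             forall i, input_lo S i xe < u i 0 < input_hi S i xe) ->
          balancing_set S xe `&` (input_box S xe)° !=set0) &
     (* and this does occur, for any rank-deficient G and any input box *)
         (exists f : 'cV[R]_n -> 'cV[R]_n,
            let S' := ControlSystem f (input_field S)
                        (input_lo S) (input_hi S) in
            [/\ standing_assumptions nu S',
                range (mulmx (input_matrix S' xe) : 'cV[R]_m -> 'cV[R]_n)
                  (drift S' xe) &
                balancing_set S' xe `&` (input_box S' xe)° !=set0])]) /\
  (* the classification is strictly more general than the ambient condition: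
     the ambient condition always implies Case (A) ... *)
  (forall (S : control_system R n m) (xe : 'cV[R]_n),
     standing_assumptions nu S ->
     ambient_condition S xe -> has_regime S xe CaseA) /\
  (* ... and in no dimension does the converse hold *)
  ((0 < n)%N -> forall xe : 'cV[R]_n, exists S : control_system R n m,
     [/\ standing_assumptions nu S,
         (\rank (input_matrix S xe) < n)%N,
         has_regime S xe CaseA &
         ~ ambient_condition S xe]).
Proof.
have rank_ambient S xe : (\rank (input_matrix S xe) < n)%N ->
    ~ @ambient_condition R n m S xe.
  by move=> rkS /ambient_full_rank rkn; rewrite rkn ltnn in rkS.
split; last split.
- move=> S xe SA rkS; split; first exact: rank_ambient.
    by move=> _ [u [bal u_in]]; exact: caseA_of_strict bal u_in.
  have [_ gC contC lohi signs] := SA.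
  pose c := box_center S xe.
  (* This constant drift makes the box centre balancing at [xe], while the input fields and the box,
     hence the rank, are kept. *)
  exists (fun=> - (input_matrix S xe *m c)) => S'.
  split.
  + by split=> //; exact: of_class_cst.
  + by exists (- c) => //=; rewrite mulmxN.
  + apply: (@caseA_of_strict _ _ _ S' xe c); first exact: addNr.
    by apply: box_center_strict => i; exact: lohi.
- by move=> S xe [_ _ _ lohi _]; apply: ambient_caseA => i; exact: lohi.
- move=> n_gt0 xe.
  (* With zero drift and zero fields every input is balancing and the rank is 0; the box with sides
     [1, 2] meets the sign condition. *)
  pose S : control_system R n m :=
    ControlSystem (fun=> 0) (fun _ _ => 0) (fun _ _ => 1) (fun _ _ => 2).
  have G0 : input_matrix S xe = 0 by apply/matrixP => i j; rewrite !mxE.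
  have rkS : (\rank (input_matrix S xe) < n)%N by rewrite G0 mxrank0.
  have lohi i x : input_lo S i x < input_hi S i x by rewrite /= ltr1n.
  exists S; split=> //; last exact: rank_ambient.
    split=> //; [exact: of_class_cst|by move=> j; exact: of_class_cst| |].
      by move=> i; split; exact: cst_continuous.
    by left=> i x; exact: ltr01.
  apply: (@caseA_of_strict _ _ _ S xe (box_center S xe)).
    by rewrite /balancing G0 mul0mx addr0.
  by apply: box_center_strict => i; exact: lohi.
Qed.
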